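(* Let $d\ge 1$ and let $\mathfrak{X}=(X,\{R_i\}_{i=0}^d)$ be a symmetric association scheme of class $d$ with adjacency matrices $A_0,\ldots,A_d$. Let $j\in\{0,1,\ldots,d\}$ and suppose that $P_j(0)$ is distinct from $P_j(1),\ldots,P_j(d)$. If $|X|>M(k_j,d-1)$, where $k_j=P_j(0)$, then $\mathfrak{X}$ is a $P$-polynomial association scheme with respect to $A_j$.
   Context: A symmetric association scheme of class $d$ is a pair $\mathfrak{X}=(X,\{R_i\}_{i=0}^d)$, where $X$ is a finite set and $R_0,\ldots,R_d$ are nonempty binary relations on $X$ such that: (i) $R_0=\{(x,x)\mid x\in X\}$; (ii) $X\times X=\bigcup_{i=0}^d R_i$ and $R_i\cap R_j=\emptyset$ for $i\neq j$; (iii) each $R_i$ is symmetric, i.e. $\{(y,x)\mid (x,y)\in R_i\}=R_i$; (iv) for any $i,j,k\in\{0,\ldots,d\}$ there is an integer $p_{ij}^k$ such that $|\{z\in X\mid (x,z)\in R_i,\ (z,y)\in R_j\}|=p_{ij}^k$ for all $(x,y)\in R_k$. The $i$-th adjacency matrix $A_i$ is the matrix indexed by $X$ with $(A_i)_{xy}=1$ if $(x,y)\in R_i$ and $0$ otherwise. The Bose--Mesner algebra is the complex algebra generated by $A_0,\ldots,A_d$; it is commutative, has basis $\{A_i\}_{i=0}^d$, and has a second basis consisting of its primitive idempotents $E_0,E_1,\ldots,E_d$, indexed so that $E_0=\frac{1}{|X|}J$ with $J$ the all-ones matrix. The numbers $P_i(j)$ are defined by $A_i=\sum_{j=0}^d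 P_i(j)E_j$. The degree $k_i=P_i(0)$ is the valency of the regular graph $(X,R_i)$. For an integer $e\ge 0$, $M(k,e)=1+k\sum_{l=0}^{e-1}(k-1)^l$, where $(k-1)^0=1$ and the empty sum is $0$. $\mathfrak{X}$ is $P$-polynomial with respect to $A_j$ if there is an ordering $A_0,A_{i_1},A_{i_2},\ldots,A_{i_d}$ of all the adjacency matrices with $i_1=j$ such that for each $l\in\{0,1,\ldots,d\}$ there exists a polynomial $v_l$ of degree $l$ with $A_{i_l}=v_l(A_j)$ (where $i_0=0$). *)

(* Defs.v *)
From HB Require Import structures.
From mathcomp Require Import all_boot all_order all_fingroup all_algebra.
From mathcomp Require Import complex reals.

Set Implicit Arguments.
Unset Strict Implicit.
Unset Printing Implicit Defensive.

Import Order.TTheory GRing.Theory Num.Theory.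
Local Open Scope ring_scope.

Record assoc_scheme (X : finType) (d : nat) := AssocScheme {
  srel :> 'I_d.+1 -> {set X * X};
  srel_neq0 : forall i, srel i != set0;
  srel_diag : srel ord0 = [set (x, x) | x : X];
  srel_cover : \bigcup_i srel i = [set: X * X];
  srel_disjoint : forall i j, i != j -> srel i :&: srel j = set0;
  srel_sym : forall i, [set (xy.2, xy.1) | xy in srel i] = srel i;
  srel_intersection : forall i j k, exists p : nat,
    forall x y, (x, y) \in srel k ->
      #|[set z | ((x, z) \in srel i) && ((z, y) \in srel j)]| = p
}.

Section AssociationScheme.
Variables (F : fieldType) (X : finType) (d : nat).

(* Matrices indexed by X are encoded as 'M_#|X| through enum_val. *)
Definition adjmx (S : assoc_scheme X d) (i : 'I_d.+1) : 'M[F]_#|X| :=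
  \matrix_(x, y) ((enum_val x, enum_val y) \in S i)%:R.

(* The F-algebra generated by the adjacency matrices; it contains the identity
   matrix, which is adjmx S ord0, and hence also 0. *)
Inductive bose_mesner (S : assoc_scheme X d) : 'M[F]_#|X| -> Prop :=
| BoseMesner_adj i : bose_mesner S (adjmx S i)
| BoseMesner_add A B :
    bose_mesner S A -> bose_mesner S B -> bose_mesner S (A + B)
| BoseMesner_scale a A : bose_mesner S A -> bose_mesner S (a *: A)
| BoseMesner_mul A B :
    bose_mesner S A -> bose_mesner S B -> bose_mesner S (A *m B).

Definition idempotent_in n (alg : 'M[F]_n -> Prop) (E : 'M[F]_n) : Prop :=
  alg E /\ E *m E = E.

(* A nonzero idempotent which is not the sum of two nonzero orthogonal
   idempotents of the algebra. *)
Definition primitive_idempotent n (alg : 'M[F]_n -> Prop) (E : 'M[F]_n) :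
    Prop :=
  [/\ idempotent_in alg E, E != 0 &
      forall G H, idempotent_in alg G -> idempotent_in alg H ->
        G *m H = 0 -> H *m G = 0 -> E = G + H -> G = 0 \/ H = 0].

Definition primitive_idempotents_of (S : assoc_scheme X d)
    (E : 'I_d.+1 -> 'M[F]_#|X|) : Prop :=
  [/\ injective E,
      forall A, primitive_idempotent (bose_mesner S) A <-> exists i, A = E i &
      E ord0 = (#|X|%:R)^-1 *: const_mx 1].

(* P i l is the number written P_i(l). *)
Definition eigenvalues_of (S : assoc_scheme X d)
    (E : 'I_d.+1 -> 'M[F]_#|X|) (P : 'I_d.+1 -> 'I_d.+1 -> F) : Prop :=
  forall i, adjmx S i = \sum_(l < d.+1) P i l *: E l.

(* Evaluation of a polynomial at a matrix; horner_mx is only available for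
   sizes of the syntactic form n.+1. *)
Definition mxeval n (v : {poly F}) (A : 'M[F]_n) : 'M[F]_n :=
  \sum_(m < size v) v`_m *: A ^+ m.

(* The permutation s is the ordering l |-> i_l; the degree of v_l is l, which
   reads size v = l.+1. *)
Definition p_polynomial_wrt (S : assoc_scheme X d) (j : 'I_d.+1) : Prop :=
  exists s : {perm 'I_d.+1},
    [/\ s ord0 = ord0,
        forall l : 'I_d.+1, l = 1%N :> nat -> s l = j &
        forall l : 'I_d.+1, exists v : {poly F},
          size v = l.+1 /\ adjmx S (s l) = mxeval v (adjmx S j)].

Definition moore_bound (k : F) (e : nat) : F :=
  1 + k * \sum_(l < e) (k - 1) ^+ l.

End AssociationScheme.

(* Main.v *)
Require Import Defs.
From mathcomp Require Import all_boot all_order all_fingroup all_algebra.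
From mathcomp Require Import complex reals.

Import Order.TTheory GRing.Theory Num.Theory.
Local Open Scope ring_scope.

(** Since [P_j(0)] is a simple eigenvalue of the regular graph [(X, R_j)], this
    graph is connected; the Moore bound then forces its diameter to be at least
    [d].  Distance in the graph is constant on each relation [R_i], so the
    [d + 1] relations are in bijection with the distances [0, ..., d].  With
    the relations ordered by distance, [A_{i_l} A_j] is a combination of
    [A_{i_0}, ..., A_{i_(l+1)}] with nonzero last coefficient, so [A_{i_(l+1)}]
    is obtained recursively as a polynomial of degree [l + 1] in [A_j]. *)

(** * Relations and intersection numbers *)

Section Relations.
Set Implicit Arguments. Unset Strict Implicit.
Variables (X : finType) (d : nat) (S : assoc_scheme X d).
Implicit Types (x y z : X) (i j k l : 'I_d.+1).

(** The default [ord0] is never reached, because the relations cover all pairs. *)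
Definition rel_index x y : 'I_d.+1 := odflt ord0 [pick i | (x, y) \in S i].

Lemma mem_srel x y i : ((x, y) \in S i) = (rel_index x y == i).
Proof.
have disj k l : (x, y) \in S k -> (x, y) \in S l -> k = l.
  move=> hk hl; apply/eqP; apply: contraT => /(srel_disjoint S)/setP/(_ (x, y)).
  by rewrite !inE hk hl.
rewrite /rel_index; case: pickP => [k hk|none] /=.
  by apply/idP/eqP => [/(disj _ _ hk)|<-].
have : (x, y) \in \bigcup_i S i by rewrite srel_cover inE.
by case/bigcupP => k _; rewrite none.
Qed.

Lemma rel_indexC x y : rel_index x y = rel_index y x.
Proof.
apply/esym/eqP; rewrite -mem_srel -(srel_sym S); apply/imsetP.
by exists (x, y); rewrite // mem_srel.
Qed.

Lemma rel_index_eq0 x y : (rel_index x y == ord0) = (x == y).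
Proof.
rewrite -mem_srel srel_diag; apply/imsetP/eqP => [[z _ [-> ->]] //|->].
by exists y.
Qed.

Lemma rel_index_surj i : exists x y, rel_index x y = i.
Proof.
by case/set0Pn: (srel_neq0 S i) => -[x y]; rewrite mem_srel => /eqP; exists x, y.
Qed.

Definition internum i l k : nat :=
  if [pick xy in S k] is Some xy
  then #|[set z | (rel_index xy.1 z == i) && (rel_index z xy.2 == l)]| else 0.

Lemma internumE x y i l :
  #|[set z | (rel_index x z == i) && (rel_index z y == l)]|
    = internum i l (rel_index x y).
Proof.
have [p hp] := srel_intersection S i l (rel_index x y).
have hp' u v : rel_index u v = rel_index x y ->
    #|[set z | (rel_index u z == i) && (rel_index z v == l)]| = p.
  move/eqP; rewrite -mem_srel => /hp <-.
  by apply: eq_card => z; rewrite !inE !mem_srel.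
rewrite hp' // /internum; case: pickP => [[u v]|/(_ (x, y))] /=.
  by rewrite mem_srel => /eqP /hp' ->.
by rewrite mem_srel eqxx.
Qed.

(** Exchanging the two endpoints swaps the roles of [i] and [l], since all relations are
    symmetric. *)
Lemma internumC i l k : internum i l k = internum l i k.
Proof.
have [x [y <-]] := rel_index_surj k; rewrite -internumE rel_indexC -internumE.
by apply: eq_card => z; rewrite !inE andbC rel_indexC (rel_indexC x).
Qed.

Lemma internum_gt0P x y i l :
  reflect (exists2 z, rel_index x z = i & rel_index z y = l)
          (0 < internum i l (rel_index x y))%N.
Proof.
rewrite -internumE; apply: (iffP card_gt0P) => -[z].
  by rewrite inE => /andP[/eqP ? /eqP ?]; exists z.
by move=> <- <-; exists z; rewrite inE !eqxx.
Qed.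

Definition valency j : nat := internum j j ord0.

Lemma card_neighbours j x : #|[set y | rel_index x y == j]| = valency j.
Proof.
have /eqP h0 : rel_index x x == ord0 by rewrite rel_index_eq0.
rewrite /valency -h0 -internumE.
by apply: eq_card => z; rewrite !inE (rel_indexC z) andbb.
Qed.

(** * Balls and spheres of relations around $R_0$ *)

Variable j : 'I_d.+1.

Definition step_closed (Q : {set 'I_d.+1}) :=
  forall l i, l \in Q -> (0 < internum l j i)%N -> i \in Q.

(** [rball m] and [rsphere m] consist of the relations at distance at most,
    respectively exactly, [m] from [R_0] in the graph of [R_j]. *)
Fixpoint rball m : {set 'I_d.+1} :=
  if m is n.+1
  then rball n :|: [set i | [exists l in rball n, (0 < internum l j i)%N]]
  else [set ord0].

Definition rsphere m : {set 'I_d.+1} :=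
  if m is n.+1 then rball n.+1 :\: rball n else [set ord0].

Lemma rball_step {m l i} :
  l \in rball m -> (0 < internum l j i)%N -> i \in rball m.+1.
Proof.
move=> hl hi; rewrite /= !inE; apply/orP; right.
by apply/existsP; exists l; rewrite hl.
Qed.

Lemma subset_rball m n : (m <= n)%N -> rball m \subset rball n.
Proof.
elim: n => [|n IH]; first by rewrite leqn0 => /eqP->.
rewrite leq_eqVlt => /orP[/eqP-> //|/IH h].
exact: subset_trans h (subsetUl _ _).
Qed.

Lemma rsphere_sub m : rsphere m \subset rball m.
Proof. by case: m => [|m]; rewrite ?subxx // subsetDl. Qed.

Lemma rballP m i :
  reflect (exists2 n, (n <= m)%N & i \in rsphere n) (i \in rball m).
Proof.
apply: (iffP idP) => [|[n hn hi]]; last first.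
  exact: (subsetP (subset_rball hn)) (subsetP (rsphere_sub n) _ hi).
elim: m => [|m IH] hi; first by exists 0.
case: (boolP (i \in rball m)) => [/IH[n hn hin]|hN].
  by exists n => //; apply: leqW.
by exists m.+1; rewrite // in_setD hN.
Qed.

Lemma rsphere_disjoint m n i : (m < n)%N -> i \in rsphere m -> i \notin rsphere n.
Proof.
case: n => // n; rewrite ltnS => hmn hi; rewrite in_setD.
by rewrite (subsetP (subset_rball hmn)) // (subsetP (rsphere_sub m)).
Qed.

Lemma rsphere_inj m n i : i \in rsphere m -> i \in rsphere n -> m = n.
Proof.
by case: (ltngtP m n) => // h; [move/(rsphere_disjoint h)/negP
  | move=> + /(rsphere_disjoint h)/negP].
Qed.

(** A predecessor of [i] in the ball of radius [m] cannot lie in a smaller ball, or [i] itself would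
    lie in the ball of radius [m]. *)
Lemma rsphere_pred m i : i \in rsphere m.+1 ->
  exists2 l, l \in rsphere m & (0 < internum l j i)%N.
Proof.
rewrite in_setD => /andP[hN]; rewrite /= in_setU (negPf hN) inE /=.
case/existsP => l /andP[hl hp]; exists l => //.
case: m hN hl => //= m hN hl; rewrite in_setD hl andbT.
by apply: contra hN => h; apply: (rball_step h).
Qed.

(** * The Moore bound on the number of points in a ball *)

Lemma card_sphere1 x : (#|[set y | rel_index x y \in rsphere 1]| <= valency j)%N.
Proof.
rewrite -(card_neighbours j x); apply/subset_leq_card/subsetP => y.
rewrite inE => /rsphere_pred[l] /set1P-> /internum_gt0P[z].
by move/eqP; rewrite rel_index_eq0 inE => /eqP-> ->.
Qed.

(** One neighbour of a point of a sphere of positive radius lies in the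
    preceding sphere, so at most [valency j - 1] lie in the next one. *)
Lemma card_sphereS x m :
  (#|[set y | rel_index x y \in rsphere m.+2]|
     <= #|[set y | rel_index x y \in rsphere m.+1]| * (valency j).-1)%N.
Proof.
pose T := [set y | rel_index x y \in rsphere m.+1].
pose F z := [set y | (rel_index x y \in rsphere m.+2) && (rel_index z y == j)].
apply: (@leq_trans #|\bigcup_(z in T) F z|).
  apply/subset_leq_card/subsetP => y; rewrite inE => hy.
  case: (rsphere_pred hy) => l hl /internum_gt0P[z hxz hzy].
  by apply/bigcupP; exists z; rewrite inE ?hxz // hy hzy eqxx.
rewrite -sum_nat_const.
apply: (@leq_trans (\sum_(z in T) #|F z|)).
  apply: (big_ind2 (fun (B : {set X}) n => #|B| <= n)%N) => [|B b C c hB hC|//].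
    by rewrite cards0.
  by apply: leq_trans (leq_card_setU _ _) (leq_add hB hC).
apply: leq_sum => z; rewrite inE => hz.
case: (rsphere_pred hz) => l hl /internum_gt0P[u hxu huz].
have hu : u \in [set y | rel_index z y == j] by rewrite inE rel_indexC huz.
rewrite -(card_neighbours j z) [X in X.-1](cardsD1 u) hu /=.
apply/subset_leq_card/subsetP => y; rewrite inE => /andP[hy hzy].
rewrite in_setD1 inE hzy andbT.
apply: contraTneq hy => ->; rewrite hxu.
exact: rsphere_disjoint hl.
Qed.

Lemma card_ball x m :
  (#|[set y | rel_index x y \in rball m]|
     <= 1 + valency j * \sum_(l < m) (valency j).-1 ^ l)%N.
Proof.
have sphere n : (#|[set y | rel_index x y \in rsphere n.+1]|
    <= valency j * (valency j).-1 ^ n)%N.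
  elim: n => [|n IH]; first by rewrite expn0 muln1 card_sphere1.
  apply: leq_trans (card_sphereS x n) _.
  by rewrite expnSr mulnA leq_mul2r IH orbT.
elim: m => [|m IH].
  rewrite big_ord0 muln0 addn0 -(cards1 x); apply/subset_leq_card/subsetP => y.
  by rewrite !inE rel_index_eq0 eq_sym.
rewrite big_ord_recr mulnDr addnA; apply: leq_trans (leq_add IH (sphere m)).
apply: leq_trans (leq_card_setU _ _); apply/subset_leq_card/subsetP => y.
by rewrite !(in_set, in_setU, in_setD) => ->; rewrite andbT orbN.
Qed.

(** * Ordering the relations by distance *)

Hypothesis connected :
  forall Q : {set 'I_d.+1}, ord0 \in Q -> step_closed Q -> Q = setT.

(** A ball that stops growing is step-closed, hence everything by connectedness. *)
Lemma rball_proper m : rball m != setT -> rball m \proper rball m.+1.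
Proof.
move=> hN; rewrite properEneq subset_rball // andbT; apply: contra hN => /eqP h.
apply/eqP/connected => [|l i hl hi]; first by apply/rballP; exists 0; rewrite ?inE.
by rewrite h (rball_step hl).
Qed.

Hypothesis far : rball d.-1 != setT.

(** Balls grow strictly from 1 relation at radius 0 to at most [d.+1] at radius [d], so each of the
    [d] steps adds exactly one. *)
Lemma rball_card m : (m <= d)%N -> #|rball m| = m.+1.
Proof.
have grow n : (m <= n)%N -> (n <= d)%N -> (#|rball m| + (n - m) <= #|rball n|)%N.
  elim: n => [|n IH]; first by rewrite leqn0 => /eqP->; rewrite addn0.
  rewrite leq_eqVlt => /orP[/eqP->|hmn hn]; first by rewrite subnn addn0.
  rewrite subSn // addnS.
  apply: leq_ltn_trans (IH hmn (ltnW hn)) (proper_card (rball_proper _)).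
  have hnd : (n <= d.-1)%N by case: (d) hn.
  apply: contraNneq far => h; rewrite -subTset -h; exact: subset_rball.
move=> hm; apply/eqP; rewrite eqn_leq; apply/andP; split.
  have := leq_trans (grow d hm (leqnn _)) (max_card _).
  by rewrite card_ord addnBA // leq_subLR addnS -addSn leq_add2r.
elim: m hm {grow} => [|m IH] hm; first by rewrite cards1.
apply: leq_ltn_trans (IH (ltnW hm)) (proper_card (rball_proper _)).
have hmd : (m <= d.-1)%N by case: (d) hm.
apply: contraNneq far => h; rewrite -subTset -h; exact: subset_rball.
Qed.

Lemma rsphere_card m : (m <= d)%N -> #|rsphere m| = 1%N.
Proof.
case: m => [|m] hm; first by rewrite cards1.
rewrite cardsD (setIidPr (subset_rball (leqnSn m))).
by rewrite !rball_card ?subSnn // ltnW.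
Qed.

Lemma distance_order :
  exists s : {perm 'I_d.+1}, forall l : 'I_d.+1, rsphere l = [set s l].
Proof.
pose f (l : 'I_d.+1) := odflt ord0 [pick i in rsphere l].
have hf l : rsphere l = [set f l].
  have /eqP/cards1P[i hi] : #|rsphere l| = 1%N.
    by apply: rsphere_card; rewrite -ltnS ltn_ord.
  rewrite /f; case: pickP => [k|/(_ i)]; rewrite hi inE ?eqxx //.
  by move/eqP->.
have finj : injective f.
  move=> l k hlk; apply/val_inj/(@rsphere_inj l k (f l)); rewrite hf ?inE //.
  by rewrite hlk.
by exists (perm finj) => l; rewrite permE.
Qed.

End Relations.

(** * Evaluating polynomials at a square matrix *)

Section MatrixEvaluation.
Set Implicit Arguments. Unset Strict Implicit.
Variables (F : fieldType) (n : nat) (A : 'M[F]_n).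
Implicit Types u v : {poly F}.

(** Padding with zero coefficients lets polynomials of different sizes be summed over a common
    range. *)
Lemma mxeval_widen v N : (size v <= N)%N ->
  mxeval v A = \sum_(m < N) v`_m *: A ^+ m.
Proof.
move=> hN; rewrite /mxeval (big_ord_widen N (fun m => v`_m *: A ^+ m) hN).
rewrite big_mkcond; apply: eq_bigr => m _; case: ltnP => // hm.
by rewrite nth_default // scale0r.
Qed.

Lemma mxeval0 : mxeval 0 A = 0.
Proof. by rewrite /mxeval size_poly0 big_ord0. Qed.

Lemma mxeval1 : mxeval 1 A = 1%:M.
Proof. by rewrite /mxeval size_poly1 big_ord1 coef1 scale1r expr0. Qed.

Lemma mxevalD u v : mxeval (u + v) A = mxeval u A + mxeval v A.
Proof.
rewrite (mxeval_widen (size_polyD u v)) (mxeval_widen (leq_maxl (size u) (size v))).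
rewrite (mxeval_widen (leq_maxr (size u) (size v))) -big_split.
by apply: eq_bigr => m _; rewrite coefD scalerDl.
Qed.

Lemma mxevalZ a v : mxeval (a *: v) A = a *: mxeval v A.
Proof.
rewrite (mxeval_widen (size_scale_leq a v)) scaler_sumr.
by apply: eq_bigr => m _; rewrite coefZ scalerA.
Qed.

Lemma mxevalXM v : mxeval ('X * v) A = mxeval v A *m A.
Proof.
have hsz : (size ('X * v)%R <= (size v).+1)%N.
  by rewrite (leq_trans (size_polyMleq _ _)) // size_polyX.
rewrite (mxeval_widen hsz) big_ord_recl coefXM scale0r add0r mulmx_suml.
by apply: eq_bigr => m _; rewrite coefXM -scalemxAl mulmxE -exprSr.
Qed.

End MatrixEvaluation.

(** * The Bose-Mesner algebra and its idempotents *)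

Section AdjacencyAlgebra.
Set Implicit Arguments. Unset Strict Implicit.
Variables (F : fieldType) (X : finType) (d : nat) (S : assoc_scheme X d).
Implicit Types (i j k l : 'I_d.+1).

Notation A := (adjmx F S).

Lemma adjmxE i x y : A i x y = (rel_index S (enum_val x) (enum_val y) == i)%:R.
Proof. by rewrite mxE mem_srel. Qed.

Lemma adjmx_combE (c : 'I_d.+1 -> F) x y :
  (\sum_i c i *: A i) x y = c (rel_index S (enum_val x) (enum_val y)).
Proof.
rewrite summxE (bigD1 (rel_index S (enum_val x) (enum_val y))) //=.
rewrite !mxE mem_srel eqxx mulr1 big1 ?addr0 // => i hi.
by rewrite !mxE mem_srel eq_sym (negPf hi) mulr0.
Qed.

Lemma adjmx0 : A ord0 = 1%:M.
Proof.
by apply/matrixP => x y; rewrite adjmxE rel_index_eq0 (inj_eq enum_val_inj) mxE.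
Qed.

Lemma sum_enum_val_card (B : pred X) :
  \sum_(z < #|X|) (B (enum_val z))%:R = #|[set z | B z]|%:R :> F.
Proof.
rewrite -sum1_card natr_sum [RHS]big_mkcond /=.
rewrite -(@big_enum_val _ _ _ _ X (fun z => (B z)%:R)).
by apply: eq_big => // z _; rewrite inE; case: (B z).
Qed.

Lemma adjmx_mul i l : A i *m A l = \sum_k (internum S i l k)%:R *: A k.
Proof.
apply/matrixP => x y; rewrite adjmx_combE -internumE -sum_enum_val_card mxE.
by apply: eq_bigr => z _; rewrite !adjmxE -natrM mulnb.
Qed.

Lemma bose_mesnerC B C :
  bose_mesner S B -> bose_mesner S C -> B *m C = C *m B :> 'M[F]_#|X|.
Proof.
(* Commuting with the generators extends to the whole algebra; this is applied once in each
   argument. *)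
have ind D : (forall i, D *m A i = A i *m D) ->
    forall C', bose_mesner S C' -> D *m C' = C' *m D.
  move=> hD C'; elim=> {C'} // [G H _ hG _ hH|a G _ hG|G H _ hG _ hH].
  - by rewrite mulmxDl mulmxDr hG hH.
  - by rewrite -scalemxAl -scalemxAr hG.
  - by rewrite mulmxA hG -mulmxA hH mulmxA.
move=> hB; apply: (ind B) => i; apply/esym; apply: (ind _ _ B hB) => l.
by rewrite !adjmx_mul; apply: eq_bigr => k _; rewrite internumC.
Qed.

(** Since $E = EG + (E - EG)$ is an orthogonal splitting, primitivity gives $EG = 0$ or $E = EG$.
    With the roles exchanged, a nonzero product would force $E = EG = G$. *)
Lemma primitive_idempotent_orth (E G : 'M[F]_#|X|) :
  primitive_idempotent (bose_mesner S) E ->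
  primitive_idempotent (bose_mesner S) G -> E != G -> E *m G = 0.
Proof.
have split_by (E' G' : 'M[F]_#|X|) : primitive_idempotent (bose_mesner S) E' ->
    idempotent_in (bose_mesner S) G' -> E' *m G' = 0 \/ E' = E' *m G'.
  case=> -[hE EE] _ prim [hG GG]; have EG := bose_mesnerC hE hG.
  have EGE : E' *m G' *m E' = E' *m G' by rewrite -mulmxA -EG mulmxA EE.
  have EGEG : E' *m G' *m (E' *m G') = E' *m G' by rewrite mulmxA EGE -mulmxA GG.
  have EEG : E' *m (E' *m G') = E' *m G' by rewrite mulmxA EE.
  case: (prim (E' *m G') (E' - E' *m G')).
  - by split=> //; apply: BoseMesner_mul.
  - split; last by rewrite mulmxBr !mulmxBl EE EGE EEG EGEG subrr subr0.
    rewrite -scaleN1r; apply: BoseMesner_add => //.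
    by apply/BoseMesner_scale/BoseMesner_mul.
  - by rewrite mulmxBr EGE EGEG subrr.
  - by rewrite mulmxBl EEG EGEG subrr.
  - by rewrite addrC subrK.
  - by left.
  - by move/eqP; rewrite subr_eq0 => /eqP; right.
move=> hE hG /eqP hEG; have [iE _ _] := hE; have [iG _ _] := hG.
have EG := bose_mesnerC iE.1 iG.1.
case: (split_by E G hE iG) => // hE'; case: (split_by G E hG iE) => hG'.
  by rewrite EG.
by case: hEG; rewrite hE' EG -hG'.
Qed.

End AdjacencyAlgebra.

(** * Eigenvalues, and connectedness from a simple valency *)

Section Spectrum.
Set Implicit Arguments. Unset Strict Implicit.
Variables (F : numFieldType) (X : finType) (d : nat) (S : assoc_scheme X d).
Variables (E : 'I_d.+1 -> 'M[F]_#|X|) (P : 'I_d.+1 -> 'I_d.+1 -> F).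
Hypotheses (hE : primitive_idempotents_of S E) (hP : eigenvalues_of S E P).
Implicit Types (i j k l : 'I_d.+1).

Notation A := (adjmx F S).

Lemma idempotentsM l k : E l *m E k = if l == k then E l else 0.
Proof.
have [inj prim _] := hE; have pr i : primitive_idempotent (bose_mesner S) (E i).
  by apply/prim; exists i.
case: eqP => [<-|/eqP hlk]; first by case: (pr l) => -[].
by apply: (primitive_idempotent_orth (pr l) (pr k)); rewrite (inj_eq inj).
Qed.

Lemma sum_idempotentsM (c : 'I_d.+1 -> F) k :
  (\sum_l c l *: E l) *m E k = c k *: E k.
Proof.
rewrite mulmx_suml (bigD1 k) //= -scalemxAl idempotentsM eqxx.
rewrite big1 ?addr0 // => l hl.
by rewrite -scalemxAl idempotentsM (negPf hl) scaler0.
Qed.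

Lemma adjmx_eigen j l : A j *m E l = P j l *: E l.
Proof. by rewrite hP sum_idempotentsM. Qed.

Lemma card_scheme_gt0 : (0 < #|X|)%N.
Proof. by have [x _] := rel_index_surj S ord0; apply/card_gt0P; exists x. Qed.

(** As $E_0$ is a multiple of the all-ones matrix, its eigenvalue under $A_j$ is the row sum of
    $A_j$. *)
Lemma eigenvalue_valency j : P j ord0 = (valency S j)%:R.
Proof.
have [_ _ E0] := hE; pose x := Ordinal card_scheme_gt0.
have /matrixP/(_ x x) := adjmx_eigen j ord0.
rewrite E0 -scalemxAr scalerA mulrC -scalerA !mxE.
have hn : (#|X|%:R : F)^-1 != 0 by rewrite invr_eq0 pnatr_eq0 -lt0n card_scheme_gt0.
move/(mulfI hn); rewrite mulr1 => <-; rewrite -(card_neighbours S j (enum_val x)).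
rewrite -sum_enum_val_card; apply: eq_bigr => z _.
by rewrite adjmxE mxE mulr1.
Qed.

Variable j : 'I_d.+1.
Hypothesis hj : forall l, l != ord0 -> P j ord0 != P j l.

(** The indicator matrix of a step-closed set [Q] is an eigenvector of [A j] for
    the simple eigenvalue [P j ord0], hence a multiple of the all-ones matrix. *)
Lemma simple_valency_connected (Q : {set 'I_d.+1}) :
  ord0 \in Q -> step_closed S j Q -> Q = setT.
Proof.
move=> Q0 Qj; pose C : 'M[F]_#|X| := \sum_i (i \in Q)%:R *: A i.
have CE x y : C x y = (rel_index S (enum_val x) (enum_val y) \in Q)%:R.
  by rewrite /C adjmx_combE.
have CA : C *m A j = P j ord0 *: C.
  apply/matrixP => x y; rewrite eigenvalue_valency mxE [RHS]mxE CE.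
  rewrite -(card_neighbours S j (enum_val y)) -sum_enum_val_card mulr_suml.
  apply: eq_bigr => z _; rewrite CE adjmxE (rel_indexC S (enum_val z)).
  case: eqP => hyz; rewrite ?mulr0 ?mul0r // mulr1 mul1r; congr (nat_of_bool _)%:R.
  (* By symmetry of $R_j$ a step can be reversed, so membership in [Q] is constant along edges. *)
  apply/idP/idP => h; apply: (Qj _ _ h); apply/internum_gt0P.
    by exists (enum_val z); rewrite // rel_indexC.
  by exists (enum_val y).
have [c Cc] : exists c : 'I_d.+1 -> F, C = \sum_l c l *: E l.
  exists (fun l => \sum_i (i \in Q)%:R * P i l); rewrite /C.
  under eq_bigr do rewrite hP scaler_sumr.
  rewrite exchange_big; apply: eq_bigr => l _; rewrite scaler_suml.
  by apply: eq_bigr => i _; rewrite scalerA.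
have [_ prim E0] := hE.
have c0 l : l != ord0 -> c l = 0.
  move=> hl; have [_ El _] : primitive_idempotent (bose_mesner S) (E l).
    by apply/prim; exists l.
  (* Multiplying [CA] by [E l] gives [c l * P j l = P j ord0 * c l], and the two eigenvalues
     differ. *)
  have := congr1 (mulmx^~ (E l)) CA.
  rewrite -mulmxA adjmx_eigen -scalemxAl -scalemxAr Cc sum_idempotentsM !scalerA.
  move/eqP; rewrite -subr_eq0 -scalerBl scaler_eq0 (negPf El) orbF -mulrBl.
  by rewrite mulf_eq0 subr_eq0 eq_sym (negPf (hj hl)) => /eqP.
have Cconst : C = const_mx (c ord0 * #|X|%:R^-1).
  rewrite Cc (bigD1 ord0) //= big1 => [|l /c0->]; last by rewrite scale0r.
  by apply/matrixP => x y; rewrite E0 addr0 scalerA !mxE mulr1.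
(* The constant is read on the diagonal, where [ord0 \in Q] makes the entry 1. *)
have C1 : c ord0 * #|X|%:R^-1 = 1.
  pose x := Ordinal card_scheme_gt0; have := CE x x.
  have /eqP-> : rel_index S (enum_val x) (enum_val x) == ord0.
    by rewrite rel_index_eq0.
  by rewrite Q0 Cconst mxE.
apply/setP => i; rewrite inE; have [x [y hxy]] := rel_index_surj S i.
have := CE (enum_rank x) (enum_rank y).
rewrite !enum_rankK hxy Cconst mxE C1; case: (i \in Q) => // /eqP.
by rewrite oner_eq0.
Qed.

(** * Adjacency matrices as polynomials in $A_j$ *)

Hypothesis far : rball S j d.-1 != setT.

Let connected := simple_valency_connected.

Lemma rsphere_poly m i : i \in rsphere S j m -> (m <= d)%N ->
  exists v : {poly F}, size v = m.+1 /\ A i = mxeval v (A j).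
Proof.
elim/ltn_ind: m i => -[|n] IH i hi hn.
  move/set1P: hi => ->; exists 1.
  by rewrite size_poly1 mxeval1 adjmx0.
have [l hl hp] := rsphere_pred hi.
have [v [hsz hv]] := IH n (ltnSn n) l hl (ltnW hn).
(* The other relations in the product are at distance at most [n.+1]; since [i] is alone in its
   sphere, they are at distance at most [n], and the strong induction hypothesis covers them. *)
have [u [husz hu]] : exists u : {poly F}, (size u <= n.+1)%N /\
    \sum_(k | k != i) (internum S l j k)%:R *: A k = mxeval u (A j).
  apply: (big_ind (fun B => exists u : {poly F}, (size u <= n.+1)%N /\ B = mxeval u (A j))).
  - by exists 0; rewrite size_poly0 mxeval0.
  - move=> B C [u [hu ->]] [w [hw ->]]; exists (u + w); rewrite mxevalD; split=> //.
    by rewrite (leq_trans (size_polyD _ _)) // geq_max hu hw.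
  move=> k hk; case: (posnP (internum S l j k)) => [->|hlk].
    by exists 0; rewrite size_poly0 mxeval0 scale0r.
  have /rballP[t ht hkt] := rball_step (subsetP (rsphere_sub S j n) _ hl) hlk.
  have htn : (t <= n)%N.
    rewrite -ltnS ltn_neqAle ht andbT; apply: contraNneq hk => htn.
    have /eqP/cards1P[b hb] := rsphere_card connected far hn.
    by move: hi hkt; rewrite htn hb !inE => /eqP-> /eqP->.
  have [w [hw ->]] := IH t htn k hkt (leq_trans htn (ltnW hn)).
  exists ((internum S l j k)%:R *: w); rewrite mxevalZ; split=> //.
  by rewrite (leq_trans (size_scale_leq _ _)) // hw.
have hp0 : (internum S l j i)%:R != 0 :> F by rewrite pnatr_eq0 -lt0n.
have hXv : size ('X * v) = n.+2.
  by rewrite mulrC size_mulX ?hsz // -size_poly_eq0 hsz.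
(* Solving $A_l A_j = p_{lj}^i A_i + u(A_j)$ for $A_i$; the term ['X * v] of size [n.+2] dominates
   [u]. *)
exists ((internum S l j i)%:R^-1 *: ('X * v + (- 1) *: u)); split.
  rewrite size_scale ?invr_eq0 // scaleN1r size_polyDl ?size_polyN hXv //.
apply: (scalerI hp0); rewrite mxevalZ scalerA divff // scale1r.
rewrite mxevalD mxevalZ mxevalXM -hv -hu adjmx_mul (bigD1 i) //=.
by rewrite scaleN1r addrK.
Qed.

Lemma p_polynomial_of_far : (1 <= d)%N -> p_polynomial_wrt F S j.
Proof.
move=> d_gt0; have [s hs] := distance_order connected far; exists s; split.
- by have /setP/(_ ord0) := hs ord0; rewrite !inE eqxx => /esym/eqP.
(* A relation at distance 1 satisfies $p_{0j}^{s(l)} > 0$, and the intermediate point is the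
   starting point. *)
- move=> l hl; have : s l \in rsphere S j 1 by rewrite -hl hs inE.
  case/rsphere_pred => i /set1P-> ; have [x [y <-]] := rel_index_surj S (s l).
  case/internum_gt0P => z /eqP; rewrite rel_index_eq0 => /eqP-> //.
move=> l; have hl : s l \in rsphere S j l by rewrite hs inE.
by apply: rsphere_poly hl _; rewrite -ltnS.
Qed.

End Spectrum.

(** * The Moore bound against the size of $X$ *)

Lemma moore_bound_nat (F : numFieldType) (k e : nat) :
  moore_bound k%:R e = (1 + k * \sum_(l < e) k.-1 ^ l)%:R :> F.
Proof.
(* For [k = 0] the truncated [k.-1] differs from $k - 1$, but the factor [k] kills both sums. *)
case: k => [|k]; first by rewrite /moore_bound !mul0r mul0n addr0 addn0.
rewrite /moore_bound natrD natrM natr_sum -natr1 addrK natr1.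
by congr (_ + _ * _); apply: eq_bigr => l _; rewrite natrX.
Qed.

Theorem theorem2p4 (R : realType) (d : nat) (hd : (1 <= d)%N) (X : finType)
    (S : assoc_scheme X d)
    (E : 'I_d.+1 -> 'M[R[i]]_#|X|) (hE : primitive_idempotents_of S E)
    (P : 'I_d.+1 -> 'I_d.+1 -> R[i]) (hP : eigenvalues_of S E P)
    (j : 'I_d.+1) (hj : forall l : 'I_d.+1, l != ord0 -> P j ord0 != P j l)
    (hX : moore_bound (P j ord0) (d - 1) < #|X|%:R) :
  p_polynomial_wrt R[i] S j.
Proof.
(* If all relations were within distance [d.-1], the ball of that radius around any point would be
   $X$, so $|X|$ would not exceed the bound. *)
apply: (p_polynomial_of_far hE hP hj) hd; apply/negP => /eqP full.
have [x _] := rel_index_surj S ord0.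
have := card_ball S j x d.-1.
have -> : [set y | rel_index S x y \in rball S j d.-1] = setT.
  by apply/setP => y; rewrite full !inE.
rewrite cardsT leqNgt => /negP; apply.
by rewrite -(ltr_nat R[i]) -moore_bound_nat -(eigenvalue_valency hE hP) -subn1.
Qed.
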